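(* Assume $\varepsilon>2M$. Let $\alpha_2\in\mathrm{LHP}_2$ be fixed, let $\phi_1\in(0,\pi)$ and put $\alpha_1=|\alpha_1|e^{i\phi_1}$. Then, as $|\alpha_1|\to\infty$ (within $\mathrm{UHP}_1$), $$I_{+-}^{\varepsilon}(\alpha_1,\alpha_2)\sim\frac{\Lambda_1(\alpha_2,\varepsilon)}{\alpha_1},\qquad \Lambda_1(\alpha_2,\varepsilon)=\frac{2i\,f\left(\frac{\pi}{2},\frac{3\pi}{2}\right)}{1+2\nu}\times\frac{1}{(\varepsilon+i\alpha_2)^{\nu+1/2}},$$ i.e. the ratio of the two sides tends to $1$.
   Context: Contours and half-planes. For $j=1,2$, $\mathcal{A}_j$ is an integration contour in the complex $\alpha_j$-plane running from $-\infty$ to $+\infty$, which coincides with the real axis outside a bounded (indented) part. $\mathrm{UHP}_j$ denotes the set of points lying on and above $\mathcal{A}_j$, $\mathrm{LHP}_j$ the set of points lying on and below $\mathcal{A}_j$, and $\mathcal{D}_{+-}=\mathrm{UHP}_1\times\mathrm{LHP}_2$. The constant $M>0$ is such that $\operatorname{Im}\alpha_1\ge -M$ for all $\alpha_1\in\mathrm{UHP}_1$ and $\operatorname{Im}\alpha_2\le M$ for all $\alpha_2\in\mathrm{LHP}_2$. Eigenfunction and exponent. Let $\ell_1$ be the first (smallest) eigenvalue of (minus) the Laplace-Beltrami operator on the unit sphere, with spherical coordinates $(\theta,\varphi)$, with Dirichlet condition on the cut $\{\theta=\pi/2,\ \varphi\in[0,\pi/2]\}$; let $f(\theta,\varphi)$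 be the associated first eigenfunction, and $\nu=\sqrt{\ell_1+1/4}\approx 0.7967$. The following properties of $f$ are taken as known: $f(\pi/2,\varphi)=0$ for $\varphi\in[0,\pi/2]$; $f(\pi/2,\cdot)$ is smooth with $0<f(\pi/2,\varphi)\le 1$ on $(\pi/2,2\pi)$; $f(\pi/2,\varphi)=\mathcal{O}(\sqrt{\varphi-\pi/2})$ as $\varphi\to\pi/2^+$ and $\mathcal{O}(\sqrt{2\pi-\varphi})$ as $\varphi\to 2\pi^-$; $f(\pi/2,\cdot)$ is strictly decreasing on $[3\pi/2,2\pi]$. The integral. For $(\alpha_1,\alpha_2)\in\mathcal{D}_{+-}$, $$I_{+-}^{\varepsilon}(\alpha_1,\alpha_2)=\int_{\frac{3\pi}{2}}^{2\pi}\frac{f\left(\frac{\pi}{2},\varphi\right)}{\bigl(-i(\alpha_1\cos\varphi+\alpha_2\sin\varphi+i\varepsilon)\bigr)^{\nu+3/2}}\,d\varphi .$$ Complex powers of numbers with positive real part are principal values. *)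

(* Defs.v *)
From Stdlib Require Import Reals.
From Coquelicot Require Import Coquelicot.

Open Scope R_scope.

(** * Contours and half-planes *)

(** A simple curve from [-oo] to [+oo], parametrized so that it is the real
    axis, traversed as [t |-> t], for [|t|] large. *)
Record is_contour (gamma : R -> C) : Prop := {
  contour_continuous : forall t, continuous gamma t;
  contour_simple : forall s t, gamma s = gamma t -> s = t;
  contour_real_at_infinity :
    exists T, forall t, T <= Rabs t -> gamma t = RtoC t
}.

Definition on_contour (gamma : R -> C) (z : C) : Prop :=
  exists t, gamma t = z.

Definition joined_off_contour (gamma : R -> C) (z w : C) : Prop :=
  exists p : R -> C,
    (forall t, 0 <= t <= 1 -> continuous p t) /\
    p 0 = z /\ p 1 = w /\
    (forall t, 0 <= t <= 1 -> ~ on_contour gamma (p t)).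

(** A point is above (below) the contour when it lies in the component of the
    complement of the contour that contains [iy] for [y] near [+oo] ([-oo]). *)
Definition above_contour (gamma : R -> C) (z : C) : Prop :=
  Rbar_locally p_infty (fun y => joined_off_contour gamma z (0, y)).

Definition below_contour (gamma : R -> C) (z : C) : Prop :=
  Rbar_locally m_infty (fun y => joined_off_contour gamma z (0, y)).

Definition UHP (gamma : R -> C) (z : C) : Prop :=
  on_contour gamma z \/ above_contour gamma z.

Definition LHP (gamma : R -> C) (z : C) : Prop :=
  on_contour gamma z \/ below_contour gamma z.

(** * Dirichlet eigenfunctions on the slit sphere *)

Definition R3 : Type := (R * R * R)%type.

Definition norm3 (p : R3) : R :=
  let '(x, y, z) := p in sqrt (x ^ 2 + y ^ 2 + z ^ 2).

Definition on_sphere (p : R3) : Prop := norm3 p = 1.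

Definition sph (theta phi : R) : R3 :=
  (sin theta * cos phi, sin theta * sin phi, cos theta).

Definition on_cut (p : R3) : Prop :=
  exists phi, 0 <= phi <= PI / 2 /\ p = sph (PI / 2) phi.

Definition radial_proj (p : R3) : R3 :=
  let '(x, y, z) := p in (x / norm3 p, y / norm3 p, z / norm3 p).

(** A function on the sphere is a function [u : R3 -> R] of which only the
    values on the sphere matter; it is handled through its extension to
    [R^3 \ {0}] that is homogeneous of degree zero. *)
Definition radial_ext (u : R3 -> R) (p : R3) : R := u (radial_proj p).

Inductive axis : Set := Ax | Ay | Az.

Definition coord (i : axis) (p : R3) : R :=
  let '(x, y, z) := p in
  match i with Ax => x | Ay => y | Az => z end.

Definition slice (i : axis) (g : R3 -> R) (p : R3) (t : R) : R :=
  let '(x, y, z) := p in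
  match i with Ax => g (t, y, z) | Ay => g (x, t, z) | Az => g (x, y, t) end.

Definition partial (i : axis) (g : R3 -> R) (p : R3) : R :=
  Derive (slice i g p) (coord i p).

Definition laplacian (g : R3 -> R) (p : R3) : R :=
  partial Ax (partial Ax g) p + partial Ay (partial Ay g) p
  + partial Az (partial Az g) p.

(** [g] is of class C^n on [U], for [U] open. *)
Fixpoint class_C (n : nat) (U : R3 -> Prop) (g : R3 -> R) : Prop :=
  (forall p, U p -> continuous g p) /\
  match n with
  | O => True
  | S m => forall i : axis,
      (forall p, U p -> ex_derive (slice i g p) (coord i p)) /\
      class_C m U (partial i g)
  end.

(** Since [r^2 Delta = d_r (r^2 d_r) + Delta_S], the Laplace-Beltrami operator
    of the unit sphere is the Euclidean Laplacian of the extension that is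
    constant along rays, evaluated at [r = 1]; unlike the expression in
    spherical coordinates, this also makes sense at the poles. *)
Definition laplace_beltrami (u : R3 -> R) (p : R3) : R :=
  laplacian (radial_ext u) p.

(** [u] is an eigenfunction of minus the Laplace-Beltrami operator for the
    eigenvalue [l], with Dirichlet condition on the cut. *)
Record is_eigenfunction (l : R) (u : R3 -> R) : Prop := {
  eigen_nonzero : exists p, on_sphere p /\ u p <> 0;
  eigen_continuous : forall p, on_sphere p -> continuous (radial_ext u) p;
  eigen_dirichlet : forall p, on_cut p -> u p = 0;
  eigen_C2 :
    class_C 2 (fun p => norm3 p <> 0 /\ ~ on_cut (radial_proj p))
      (radial_ext u);
  eigen_equation : forall p, on_sphere p -> ~ on_cut p ->
    - laplace_beltrami u p = l * u p
}.

Definition is_first_eigenvalue (l : R) : Prop :=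
  (exists u, is_eigenfunction l u) /\
  (forall l' u, is_eigenfunction l' u -> l <= l').

Definition in_spherical_coords (u : R3 -> R) (theta phi : R) : R :=
  u (sph theta phi).

(** The known properties of the trace [h = f(pi/2, .)] of the first
    eigenfunction on the equator. *)
Record equatorial_trace_properties (h : R -> R) : Prop := {
  trace_cut : forall phi, 0 <= phi <= PI / 2 -> h phi = 0;
  trace_smooth : forall n phi, PI / 2 < phi < 2 * PI -> ex_derive_n h n phi;
  trace_range : forall phi, PI / 2 < phi < 2 * PI -> 0 < h phi <= 1;
  trace_edge_left :
    exists K delta, 0 < delta /\
      forall phi, PI / 2 < phi < PI / 2 + delta ->
        Rabs (h phi) <= K * sqrt (phi - PI / 2);
  trace_edge_right :
    exists K delta, 0 < delta /\
      forall phi, 2 * PI - delta < phi < 2 * PI ->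
        Rabs (h phi) <= K * sqrt (2 * PI - phi);
  trace_decreasing : forall phi psi,
    3 * PI / 2 <= phi -> phi < psi -> psi <= 2 * PI -> h psi < h phi
}.

Definition exponent (l1 : R) : R := sqrt (l1 + 1 / 4).

(** * The integral and its asymptotics *)

(** Principal argument, in [(-pi, pi]], of a nonzero complex number. *)
Definition Carg (z : C) : R :=
  if Rle_dec 0 (Im z) then acos (Re z / Cmod z) else - acos (Re z / Cmod z).

Definition polar (r phi : R) : C := (r * cos phi, r * sin phi).

(** Principal value of [z^s] for real [s] and [z <> 0]. *)
Definition Cpowr (z : C) (s : R) : C :=
  polar (exp (s * ln (Cmod z))) (s * Carg z).

Definition I_pm (f : R -> R -> R) (nu eps : R) (alpha1 alpha2 : C) : C :=
  RInt (V := C_R_CompleteNormedModule)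
    (fun phi : R =>
       (RtoC (f (PI / 2)%R phi) /
        Cpowr (- Ci * (alpha1 * RtoC (cos phi) + alpha2 * RtoC (sin phi)
                       + Ci * RtoC eps)) (nu + 3 / 2)%R)%C)
    (3 * PI / 2) (2 * PI).

Definition Lambda1 (f : R -> R -> R) (nu : R) (alpha2 : C) (eps : R) : C :=
  (RtoC 2 * Ci * RtoC (f (PI / 2)%R (3 * PI / 2)%R) / RtoC (1 + 2 * nu)%R
   * (RtoC 1 / Cpowr (RtoC eps + Ci * alpha2) (nu + 1 / 2)%R))%C.

Definition asymp_equiv {T : Type} (F : (T -> Prop) -> Prop) (g h : T -> C) :
    Prop :=
  filterlim (fun x => (g x / h x)%C) F (locally (RtoC 1)).

(* Main.v *)
Require Import Defs.
From Stdlib Require Import Reals Lra.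
From Coquelicot Require Import Coquelicot.

(** Only the immediate neighbourhood of the endpoint [3 pi/2] matters, because
    there the coefficient [cos phi] of [alpha1] vanishes. Write
    [D = -i (alpha1 cos phi + alpha2 sin phi + i eps)], [h = f (pi/2, .)],
    [h0 = h (3 pi/2)] and [w = -(nu + 1/2)], so that the integrand is
    [h D^(w-1)]. Since [D' = -i alpha1] at [3 pi/2], the function
    [-i alpha1 h] is replaced by [h0 D'], for which the integral is known
    exactly: [D' D^(w-1)] has the primitive [D^w / w]. Its value at the lower
    end, where [D = eps + i alpha2], gives [Lambda1]; its value at the upper
    end tends to zero because [|D (2 pi)|] grows like [|alpha1|].

    What remains is the integral of [(-i alpha1 h - h0 D') D^(w-1)]. With
    [t = phi - 3 pi/2] and [r = |alpha1|], the first factor is [O (r t)],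
    because [h] is differentiable at [3 pi/2] ([Cmod_numerator_le]). On the
    other hand [Im alpha1 = r sin phi1] gives
    [|D| >= delta + q r t] with [delta = eps - M] and a constant [q > 0]
    ([Cmod_phase_ge]). As [|D^(w-1)| = |D|^(-nu-3/2)] and [nu >= 0], the
    integrand is [O (1 / sqrt (delta + q r t))], whose integral is
    [O (1 / sqrt r)] ([remainder_bound]). Altogether
    [alpha1 I - Lambda1 = O (|alpha1|^(-1/2))], uniformly in closed sectors of
    the open upper half-plane ([I_pm_error]); since [h0 > 0] makes [Lambda1]
    nonzero, the ratio tends to [1]. *)

Open Scope R_scope.

(** * Principal powers in the right half-plane *)

Lemma Carg_right (z : C) : 0 < Re z -> Carg z = atan (Im z / Re z).
Proof.
  intros Hx.
  assert (Hm : Cmod z <> 0).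
  { intros E. apply Cmod_eq_0 in E. rewrite E in Hx. simpl in Hx. lra. }
  assert (Hm' : 0 < Cmod z) by (pose proof (Cmod_ge_0 z); lra).
  assert (Hsq : Cmod z * Cmod z = Re z * Re z + Im z * Im z).
  { unfold Cmod, Re, Im. rewrite sqrt_sqrt; [ring | nra]. }
  assert (Hratio : sqrt (1 - (Re z / Cmod z)²) / (Re z / Cmod z)
                   = Rabs (Im z) / Re z).
  { replace (1 - (Re z / Cmod z)²) with ((Im z / Cmod z)²).
    - rewrite sqrt_Rsqr_abs, Rabs_div, (Rabs_pos_eq (Cmod z)) by lra.
      field. lra.
    - unfold Rsqr.
      replace (1 - Re z / Cmod z * (Re z / Cmod z))
        with ((Cmod z * Cmod z - Re z * Re z) / (Cmod z * Cmod z))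
        by (field; lra).
      rewrite Hsq at 1. field. lra. }
  unfold Carg.
  rewrite acos_atan, Hratio by (apply Rdiv_lt_0_compat; lra).
  destruct (Rle_dec 0 (Im z)).
  - now rewrite Rabs_pos_eq.
  - rewrite Rabs_left by lra. rewrite <- atan_opp. f_equal. field. lra.
Qed.

Lemma polar_Cmod_Carg (z : C) : 0 < Re z -> polar (Cmod z) (Carg z) = z.
Proof.
  intros Hx. rewrite Carg_right by assumption.
  assert (Hroot : sqrt (1 + (Im z / Re z)²) = Cmod z / Re z).
  { apply sqrt_lem_1.
    - pose proof (Rle_0_sqr (Im z / Re z)). lra.
    - apply Rle_mult_inv_pos; [apply Cmod_ge_0 | lra].
    - unfold Cmod, Re, Im, Rsqr in *.
      set (s := sqrt _).
      assert (Hs : s * s = fst z * fst z + snd z * snd z)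
        by (unfold s; rewrite sqrt_sqrt; [ring | nra]).
      transitivity (s * s / (fst z * fst z)); [field; lra|].
      rewrite Hs. field. lra. }
  assert (Hm : Cmod z <> 0).
  { intros E. apply Cmod_eq_0 in E. rewrite E in Hx. simpl in Hx. lra. }
  unfold polar. rewrite cos_atan, sin_atan, Hroot.
  destruct z as [x y]; simpl in *. f_equal; field; lra.
Qed.

Lemma polar_mult (r s a b : R) :
  (polar r a * polar s b)%C = polar (r * s) (a + b).
Proof.
  unfold polar, Cmult; simpl. rewrite cos_plus, sin_plus. f_equal; ring.
Qed.

Lemma Cmod_polar (r a : R) : 0 <= r -> Cmod (polar r a) = r.
Proof.
  intros Hr. unfold polar, Cmod; simpl.
  transitivity (sqrt (r * r)); [f_equal | now apply sqrt_square].
  pose proof (sin2_cos2 a) as E. unfold Rsqr in E.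
  replace (r * r) with (r * r * (sin a * sin a + cos a * cos a))
    by (rewrite E; ring).
  ring.
Qed.

Lemma Cpowr_plus (z : C) (a b : R) :
  Cpowr z (a + b) = (Cpowr z a * Cpowr z b)%C.
Proof.
  unfold Cpowr. rewrite polar_mult, <- exp_plus. f_equal; [f_equal|]; ring.
Qed.

Lemma Cpowr_0 (z : C) : Cpowr z 0 = RtoC 1.
Proof.
  unfold Cpowr, polar. rewrite !Rmult_0_l, exp_0, cos_0, sin_0.
  unfold RtoC. f_equal; ring.
Qed.

Lemma Cpowr_1 (z : C) : 0 < Re z -> Cpowr z 1 = z.
Proof.
  intros Hx. unfold Cpowr. rewrite !Rmult_1_l, exp_ln.
  - now apply polar_Cmod_Carg.
  - apply Cmod_gt_0. intros E. rewrite E in Hx. simpl in Hx. lra.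
Qed.

Lemma Cmod_Cpowr (z : C) (s : R) : Cmod (Cpowr z s) = Rpower (Cmod z) s.
Proof. apply Cmod_polar, Rlt_le, exp_pos. Qed.

Lemma Cpowr_neq_0 (z : C) (s : R) : Cpowr z s <> RtoC 0.
Proof.
  apply Cmod_gt_0. rewrite Cmod_Cpowr. apply exp_pos.
Qed.

Lemma Cpowr_opp (z : C) (s : R) : Cpowr z (- s) = (/ Cpowr z s)%C.
Proof.
  assert (E : (Cpowr z s * Cpowr z (- s))%C = RtoC 1)
    by (rewrite <- Cpowr_plus, Rplus_opp_r; apply Cpowr_0).
  pose proof (Cpowr_neq_0 z s) as Hn.
  transitivity (/ Cpowr z s * (Cpowr z s * Cpowr z (- s)))%C.
  - field. assumption.
  - rewrite E. ring.
Qed.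

(** * Calculus for complex-valued functions of a real variable *)

Lemma is_derive_pair (g : R -> C) (t : R) (l : C) :
  is_derive (fun s => fst (g s)) t (fst l) ->
  is_derive (fun s => snd (g s)) t (snd l) ->
  is_derive (K := R_AbsRing) (V := C_R_NormedModule) g t l.
Proof.
  intros H1 H2.
  apply (filterdiff_ext_lin
    (K := R_AbsRing) (U := R_NormedModule) (V := C_R_NormedModule) g
    (fun y => (scal y (fst l), scal y (snd l)))).
  2: { intros y. destruct l. reflexivity. }
  apply (filterdiff_ext
    (K := R_AbsRing) (U := R_NormedModule) (V := C_R_NormedModule)
    (fun s => (fst (g s), snd (g s)))).
  1: { intros s. symmetry. apply surjective_pairing. }
  apply (filterdiff_comp_2 (K := R_AbsRing) (T := R_NormedModule)
    (U := R_NormedModule) (V := R_NormedModule) (W := C_R_NormedModule)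
    (fun s => fst (g s)) (fun s => snd (g s)) (fun a b => (a, b))
    (fun y => scal y (fst l)) (fun y => scal y (snd l)) (fun a b => (a, b))
    H1 H2).
  apply (filterdiff_ext (K := R_AbsRing)
    (U := prod_NormedModule R_AbsRing R_NormedModule R_NormedModule)
    (V := C_R_NormedModule) (fun p => p)).
  { intros p. apply surjective_pairing. }
  apply (filterdiff_ext_lin (K := R_AbsRing)
    (U := prod_NormedModule R_AbsRing R_NormedModule R_NormedModule)
    (V := C_R_NormedModule) _ (fun p => p)).
  2: { intros p. apply surjective_pairing. }
  apply filterdiff_linear.
  apply (is_linear_id (K := R_AbsRing)
    (V := prod_NormedModule R_AbsRing R_NormedModule R_NormedModule)).
Qed.

Lemma Cpowr_right (z : C) (w : R) : 0 < Re z ->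
  Cpowr z w
  = polar (exp (w * (ln (Re z * Re z + Im z * Im z) / 2)))
      (w * atan (Im z / Re z)).
Proof.
  intros Hx. unfold Cpowr. rewrite Carg_right by assumption.
  f_equal. do 2 f_equal.
  unfold Cmod. rewrite <- Rpower_sqrt by (unfold Re in Hx; nra).
  unfold Rpower. rewrite ln_exp. unfold Re, Im.
  replace (fst z ^ 2 + snd z ^ 2) with (fst z * fst z + snd z * snd z) by ring.
  field.
Qed.

(** Near a point of the right half-plane the argument is [atan (Im z / Re z)],
    so that the power is an elementary function of the coordinates. *)
Lemma is_derive_Cpowr (z : R -> C) (w t : R) (dz : C) :
  is_derive (fun s => Re (z s)) t (Re dz) ->
  is_derive (fun s => Im (z s)) t (Im dz) ->
  0 < Re (z t) ->
  is_derive (K := R_AbsRing) (V := C_R_NormedModule)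
    (fun s => Cpowr (z s) w) t (RtoC w * dz * Cpowr (z t) (w - 1))%C.
Proof.
  intros H1 H2 Hx.
  assert (Hloc : locally t (fun s => 0 < Re (z s))).
  { apply (ex_derive_continuous (V := R_NormedModule) (fun s => Re (z s)) t
             (ex_intro _ _ H1)).
    now apply open_gt. }
  apply (is_derive_ext_loc (K := R_AbsRing) (V := C_R_NormedModule)
    (fun s => polar (exp (w * (ln (Re (z s) * Re (z s) + Im (z s) * Im (z s)) / 2)))
      (w * atan (Im (z s) / Re (z s))))).
  { apply (filter_imp (fun s => 0 < Re (z s))); [|exact Hloc].
    intros s Hs. symmetry. now apply Cpowr_right. }
  (* The derivative of [exp (w log z)] comes out as [w (dz / z) z^w]. *)
  assert (E : (RtoC w * dz * Cpowr (z t) (w - 1))%C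
              = (RtoC w * (dz / z t) * Cpowr (z t) w)%C).
  { unfold Rminus. rewrite Cpowr_plus, Cpowr_opp, Cpowr_1 by assumption.
    unfold Cdiv. ring. }
  rewrite E, Cpowr_right by assumption.
  set (x := fun s => Re (z s)) in *. set (y := fun s => Im (z s)) in *.
  assert (Ex : Derive x t = Re dz) by exact (is_derive_unique x t _ H1).
  assert (Ey : Derive y t = Im dz) by exact (is_derive_unique y t _ H2).
  apply is_derive_pair.
  - change (is_derive (K := R_AbsRing) (V := R_NormedModule)
      (fun s => exp (w * (ln (x s * x s + y s * y s) / 2))
                * cos (w * atan (y s / x s))) t
      (fst (RtoC w * (dz / z t) * polar
         (exp (w * (ln (x t * x t + y t * y t) / 2)))
         (w * atan (y t / x t)))%C)).
    change (0 < x t) in Hx.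
    auto_derive; unfold Rsqr; simpl.
    + repeat split; try lra; try nra; eexists; eassumption.
    + change (Derive (fun s => x s) t) with (Derive x t).
      change (Derive (fun s => y s) t) with (Derive y t).
      rewrite Ex, Ey.
      change (fst (z t)) with (x t). change (snd (z t)) with (y t).
      unfold Re, Im, Rdiv.
      clear - Hx. clearbody x y.
      generalize (exp (w * (ln (x t * x t + y t * y t) * / 2)))
        (cos (w * atan (y t * / x t))) (sin (w * atan (y t * / x t))).
      intros e c s. field. repeat split; nra.
  - change (is_derive (K := R_AbsRing) (V := R_NormedModule)
      (fun s => exp (w * (ln (x s * x s + y s * y s) / 2))
                * sin (w * atan (y s / x s))) t
      (snd (RtoC w * (dz / z t) * polar
         (exp (w * (ln (x t * x t + y t * y t) / 2)))
         (w * atan (y t / x t)))%C)).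
    change (0 < x t) in Hx.
    auto_derive; unfold Rsqr; simpl.
    + repeat split; try lra; try nra; eexists; eassumption.
    + change (Derive (fun s => x s) t) with (Derive x t).
      change (Derive (fun s => y s) t) with (Derive y t).
      rewrite Ex, Ey.
      change (fst (z t)) with (x t). change (snd (z t)) with (y t).
      unfold Re, Im, Rdiv.
      clear - Hx. clearbody x y.
      generalize (exp (w * (ln (x t * x t + y t * y t) * / 2)))
        (cos (w * atan (y t * / x t))) (sin (w * atan (y t * / x t))).
      intros e c s. field. repeat split; nra.
Qed.

Lemma continuous_C_pair (g : R -> C) (t : R) :
  continuous (fun s => fst (g s)) t -> continuous (fun s => snd (g s)) t ->
  continuous (g : R -> C_R_NormedModule) t.
Proof.
  intros H1 H2.
  apply (continuous_ext (fun s => (fst (g s), snd (g s)) : C_R_NormedModule)).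
  { intros s. symmetry. apply surjective_pairing. }
  apply (continuous_comp_2 (fun s => fst (g s)) (fun s => snd (g s))
    (fun x y => (x, y) : C_R_NormedModule)); [exact H1 | exact H2 |].
  apply (continuous_ext (fun p : R * R => p)).
  { intros p. apply surjective_pairing. }
  apply continuous_id.
Qed.

Lemma continuous_Cmult (g k : R -> C) (t : R) :
  continuous (g : R -> C_R_NormedModule) t ->
  continuous (k : R -> C_R_NormedModule) t ->
  continuous ((fun s => (g s * k s)%C) : R -> C_R_NormedModule) t.
Proof.
  intros Hg Hk.
  assert (Hg1 : continuous (fun s => fst (g s)) t)
    by (apply (continuous_comp g fst); [exact Hg | apply continuous_fst]).
  assert (Hg2 : continuous (fun s => snd (g s)) t)
    by (apply (continuous_comp g snd); [exact Hg | apply continuous_snd]).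
  assert (Hk1 : continuous (fun s => fst (k s)) t)
    by (apply (continuous_comp k fst); [exact Hk | apply continuous_fst]).
  assert (Hk2 : continuous (fun s => snd (k s)) t)
    by (apply (continuous_comp k snd); [exact Hk | apply continuous_snd]).
  apply continuous_C_pair; simpl.
  - apply (continuous_minus (V := R_NormedModule));
      now apply (continuous_mult (K := R_AbsRing)).
  - apply (continuous_plus (V := R_NormedModule));
      now apply (continuous_mult (K := R_AbsRing)).
Qed.

Lemma continuous_Cpowr (z : R -> C) (w t : R) :
  ex_derive (fun s => Re (z s)) t -> ex_derive (fun s => Im (z s)) t ->
  0 < Re (z t) ->
  continuous ((fun s => Cpowr (z s) w) : R -> C_R_NormedModule) t.
Proof.
  intros [d1 H1] [d2 H2] Hx.
  apply (ex_derive_continuous (K := R_AbsRing) (V := C_R_NormedModule)).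
  eexists. now apply (is_derive_Cpowr z w t (d1, d2)).
Qed.

(** * The base of the power and its exact integral *)

(** The base of the power in the integrand of [I_pm]. *)
Definition phase (alpha1 alpha2 : C) (eps phi : R) : C :=
  (- Ci * (alpha1 * RtoC (cos phi) + alpha2 * RtoC (sin phi)
           + Ci * RtoC eps))%C.

Definition dphase (alpha1 alpha2 : C) (phi : R) : C :=
  (Ci * (alpha1 * RtoC (sin phi) - alpha2 * RtoC (cos phi)))%C.

Lemma Re_phase (alpha1 alpha2 : C) (eps phi : R) :
  Re (phase alpha1 alpha2 eps phi)
  = eps + Im alpha1 * cos phi + Im alpha2 * sin phi.
Proof. unfold phase, Re, Im; simpl. ring. Qed.

Lemma is_derive_Re_phase (alpha1 alpha2 : C) (eps phi : R) :
  is_derive (fun s => Re (phase alpha1 alpha2 eps s)) phi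
    (Re (dphase alpha1 alpha2 phi)).
Proof.
  unfold phase, dphase, Re; simpl. auto_derive; [exact I | ring].
Qed.

Lemma is_derive_Im_phase (alpha1 alpha2 : C) (eps phi : R) :
  is_derive (fun s => Im (phase alpha1 alpha2 eps s)) phi
    (Im (dphase alpha1 alpha2 phi)).
Proof.
  unfold phase, dphase, Im; simpl. auto_derive; [exact I | ring].
Qed.

Lemma continuous_dphase (alpha1 alpha2 : C) (phi : R) :
  continuous (dphase alpha1 alpha2 : R -> C_R_NormedModule) phi.
Proof.
  apply continuous_C_pair; unfold dphase; simpl;
    apply (ex_derive_continuous (V := R_NormedModule)); auto_derive; exact I.
Qed.

Lemma continuous_Cpowr_phase (alpha1 alpha2 : C) (eps w phi : R) :
  0 < Re (phase alpha1 alpha2 eps phi) ->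
  continuous ((fun s => Cpowr (phase alpha1 alpha2 eps s) w)
              : R -> C_R_NormedModule) phi.
Proof.
  intros Hpos. apply continuous_Cpowr; [| | assumption]; eexists.
  - apply is_derive_Re_phase.
  - apply is_derive_Im_phase.
Qed.

(** This integral carries the whole leading term. *)
Lemma is_RInt_Cpowr_phase (alpha1 alpha2 : C) (eps w a b : R) :
  a <= b ->
  (forall phi, a <= phi <= b -> 0 < Re (phase alpha1 alpha2 eps phi)) ->
  is_RInt (V := C_R_NormedModule)
    (fun phi => (RtoC w * dphase alpha1 alpha2 phi
                 * Cpowr (phase alpha1 alpha2 eps phi) (w - 1))%C) a b
    (Cpowr (phase alpha1 alpha2 eps b) w
     - Cpowr (phase alpha1 alpha2 eps a) w)%C.
Proof.
  intros Hab Hpos.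
  apply (is_RInt_derive (V := C_R_CompleteNormedModule)
    (fun phi => Cpowr (phase alpha1 alpha2 eps phi) w));
    rewrite Rmin_left, Rmax_right by assumption; intros phi Hphi.
  - apply is_derive_Cpowr; [| | now apply Hpos].
    + apply is_derive_Re_phase.
    + apply is_derive_Im_phase.
  - apply continuous_Cmult; [apply continuous_Cmult|].
    + apply continuous_const.
    + apply continuous_dphase.
    + apply continuous_Cpowr_phase. now apply Hpos.
Qed.

(** * Continuity of the trace of an eigenfunction *)

Lemma norm3_sph (theta phi : R) : norm3 (sph theta phi) = 1.
Proof.
  unfold norm3, sph. rewrite <- sqrt_1. f_equal.
  pose proof (sin2_cos2 theta) as E1. pose proof (sin2_cos2 phi) as E2.
  unfold Rsqr in *.
  replace 1 with (sin theta * sin theta * 1 + cos theta * cos theta * 1)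
    by (rewrite !Rmult_1_r; exact E1).
  rewrite <- E2 at 1. rewrite Rmult_1_r. ring.
Qed.

Lemma radial_ext_sph (u : R3 -> R) (theta phi : R) :
  radial_ext u (sph theta phi) = u (sph theta phi).
Proof.
  unfold radial_ext, radial_proj. pose proof (norm3_sph theta phi) as E.
  unfold sph in *. rewrite E. unfold Rdiv. now rewrite Rinv_1, !Rmult_1_r.
Qed.

(** Continuity on the whole circle, the edge [phi = 2 pi] of the cut included,
    is what makes the integrand of [I_pm] Riemann integrable up to the
    endpoint. *)
Lemma continuous_eigenfunction_sph (l : R) (u : R3 -> R) (theta phi : R) :
  is_eigenfunction l u -> continuous (fun s => u (sph theta s)) phi.
Proof.
  intros Hu.
  apply (continuous_ext (fun s => radial_ext u (sph theta s))).
  { intros s. apply radial_ext_sph. }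
  apply (continuous_comp (sph theta) (radial_ext u)).
  2: { apply (eigen_continuous _ _ Hu). apply norm3_sph. }
  unfold sph.
  apply (continuous_comp_2 (fun s => (sin theta * cos s, sin theta * sin s))
    (fun _ => cos theta) (fun p z => (p, z))).
  - apply (continuous_C_pair (fun s => (sin theta * cos s, sin theta * sin s)));
      simpl; apply (ex_derive_continuous (V := R_NormedModule));
      auto_derive; exact I.
  - apply continuous_const.
  - apply (continuous_ext (fun p : (R * R) * R => p)).
    { intros p. apply surjective_pairing. }
    apply continuous_id.
Qed.

(** * Elementary bounds *)

(** The lower bound [d] is spent on the exponent [nu], of which only the sign
    is known, and the bound [rho] on the exponent [s]. *)
Lemma Rpower_opp_le (nu s d rho m : R) :
  0 <= nu -> 0 < s -> 0 < d -> d <= m -> 0 < rho -> rho <= m ->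
  Rpower m (- (nu + s)) <= / (Rpower d nu * Rpower rho s).
Proof.
  intros Hnu Hs Hd Hdm Hrho Hrm.
  rewrite Rpower_Ropp, Rpower_plus.
  apply Rinv_le_contravar.
  - apply Rmult_lt_0_compat; apply exp_pos.
  - apply Rmult_le_compat; try (apply Rlt_le, exp_pos);
      apply Rle_Rpower_l; lra.
Qed.

(** Differentiability gives the bound near [a]; away from [a] boundedness
    suffices, at the price of a larger constant. *)
Lemma linear_bound (k : R -> R) (a b B : R) :
  ex_derive k a -> k a = 0 ->
  (forall x, a <= x <= b -> Rabs (k x) <= B) ->
  exists L, 0 <= L /\ forall x, a <= x <= b -> Rabs (k x) <= L * (x - a).
Proof.
  intros [l Hl] H0 HB.
  apply is_derive_Reals in Hl.
  destruct (Hl 1 Rlt_0_1) as [d Hd].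
  pose proof (cond_pos d) as Hdpos.
  set (L := Rmax (Rabs l + 1) (Rabs B / d)).
  assert (HL1 : Rabs l + 1 <= L) by apply Rmax_l.
  assert (HL2 : Rabs B / d <= L) by apply Rmax_r.
  pose proof (Rabs_pos l) as Hlp.
  exists L. split; [lra|]. intros x Hx.
  destruct (Req_dec x a) as [->|Hne].
  { rewrite H0, Rabs_R0. lra. }
  destruct (Rlt_dec (x - a) d) as [Hlt|Hge].
  - specialize (Hd (x - a)).
    replace (a + (x - a)) with x in Hd by ring.
    rewrite H0, Rminus_0_r, (Rabs_pos_eq (x - a)) in Hd by lra.
    specialize (Hd ltac:(lra) Hlt).
    apply Rle_trans with ((Rabs l + 1) * (x - a)).
    + replace (k x) with (k x / (x - a) * (x - a)) by (field; lra).
      rewrite Rabs_mult, (Rabs_pos_eq (x - a)) by lra.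
      apply Rmult_le_compat_r; [lra|].
      pose proof (Rabs_triang (k x / (x - a) - l) l) as Ht.
      replace (k x / (x - a) - l + l) with (k x / (x - a)) in Ht by ring.
      lra.
    + apply Rmult_le_compat_r; lra.
  - apply Rle_trans with B; [now apply HB|].
    apply Rle_trans with (Rabs B / d * d).
    + replace (Rabs B / d * d) with (Rabs B) by (field; lra).
      apply Rle_abs.
    + apply Rle_trans with (L * d).
      * apply Rmult_le_compat_r; lra.
      * apply Rmult_le_compat_l; lra.
Qed.

(** [sin t >= t - t^3/6], and [t <= 2] on the interval; the constant is far
    from optimal. *)
Lemma sin_ge_third (t : R) : 0 <= t <= PI / 2 -> t / 3 <= sin t.
Proof.
  intros Ht. pose proof PI_4.
  destruct (pre_sin_bound t 0 ltac:(lra) ltac:(lra)) as [Hsin _].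
  unfold sin_approx, sin_term in Hsin. simpl in Hsin.
  apply Rle_trans with (2 := Hsin).
  assert (t * t <= 4) by nra. nra.
Qed.

(** The majorant of the remainder, which is [O (1 / sqrt q)] as [q] grows. *)
Lemma is_RInt_inv_sqrt (d q a b : R) : 0 < d -> 0 < q -> a <= b ->
  is_RInt (fun x => / sqrt (d + q * (x - a))) a b
    (2 / q * (sqrt (d + q * (b - a)) - sqrt d)).
Proof.
  intros Hd Hq Hab.
  replace (2 / q * (sqrt (d + q * (b - a)) - sqrt d))
    with (minus (2 / q * sqrt (d + q * (b - a)))
                (2 / q * sqrt (d + q * (a - a)))).
  2: { unfold minus, plus, opp; simpl.
       replace (d + q * (a - a)) with d by ring. ring. }
  apply (is_RInt_derive (V := R_CompleteNormedModule)
    (fun x => 2 / q * sqrt (d + q * (x - a)))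
    (fun x => / sqrt (d + q * (x - a))));
    rewrite Rmin_left, Rmax_right by assumption; intros x Hx;
    assert (Hpos : 0 < d + q * (x - a)) by nra;
    pose proof (sqrt_lt_R0 _ Hpos) as Hroot.
  - auto_derive; [lra|]. unfold Rminus in *. field. lra.
  - apply (ex_derive_continuous (V := R_NormedModule)).
    auto_derive. unfold Rminus in *. split; [lra|]. split; [lra|exact I].
Qed.

Lemma sin_sub_3PI2 (phi : R) : sin (phi - 3 * PI / 2) = cos phi.
Proof.
  replace (phi - 3 * PI / 2) with (- (3 * (PI / 2) - phi)) by lra.
  rewrite sin_antisym, sin_minus, cos_3PI2, sin_3PI2. ring.
Qed.

(** On this interval [sin phi] lies in [[-1, 0]], so [alpha2] lowers the real
    part [eps + Im alpha1 cos phi + Im alpha2 sin phi] by at most [M], while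
    [cos phi] is at least a third of the distance to the left endpoint. *)
Lemma Re_phase_ge (M eps : R) (alpha1 alpha2 : C) (phi : R) :
  0 <= M -> 0 <= Im alpha1 -> Im alpha2 <= M ->
  3 * PI / 2 <= phi <= 2 * PI ->
  eps - M + Im alpha1 / 3 * (phi - 3 * PI / 2)
  <= Re (phase alpha1 alpha2 eps phi).
Proof.
  intros HM H1 H2 Hphi. rewrite Re_phase.
  pose proof (sin_ge_third (phi - 3 * PI / 2) ltac:(lra)) as Hcos.
  rewrite sin_sub_3PI2 in Hcos.
  pose proof (SIN_bound phi) as Hsin.
  assert (Hneg : sin phi <= 0) by (apply sin_le_0; pose proof PI_RGT_0; lra).
  assert (- M <= Im alpha2 * sin phi) by nra.
  nra.
Qed.

Lemma Cmod_phase_ge (M kappa eps : R) (alpha1 alpha2 : C) (phi : R) :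
  0 <= M -> 0 <= kappa -> kappa * Cmod alpha1 <= Im alpha1 ->
  Im alpha2 <= M -> 3 * PI / 2 <= phi <= 2 * PI ->
  eps - M + kappa * Cmod alpha1 / 3 * (phi - 3 * PI / 2)
  <= Cmod (phase alpha1 alpha2 eps phi).
Proof.
  intros HM Hk H1 H2 Hphi.
  assert (H0 : 0 <= Im alpha1) by (pose proof (Cmod_ge_0 alpha1); nra).
  apply Rle_trans with (2 := re_le_Cmod _).
  apply Rle_trans with (2 := Rle_abs _).
  apply Rle_trans with (2 := Re_phase_ge M eps alpha1 alpha2 phi HM H0 H2 Hphi).
  nra.
Qed.

Lemma is_RInt_Cmult_l (g : R -> C) (a b : R) (c l : C) :
  is_RInt (V := C_R_NormedModule) g a b l ->
  is_RInt (V := C_R_NormedModule) (fun x => (c * g x)%C) a b (c * l)%C.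
Proof.
  intros Hg.
  pose proof (is_RInt_fct_extend_fst (U := R_NormedModule)
    (V := R_NormedModule) g a b l Hg) as H1.
  pose proof (is_RInt_fct_extend_snd (U := R_NormedModule)
    (V := R_NormedModule) g a b l Hg) as H2.
  apply (is_RInt_fct_extend_pair (U := R_NormedModule) (V := R_NormedModule)
    (fun x => (c * g x)%C)); simpl.
  - apply (is_RInt_minus (V := R_NormedModule)
      (fun x => fst c * fst (g x)) (fun x => snd c * snd (g x)));
      now apply (is_RInt_scal (V := R_NormedModule)).
  - apply (is_RInt_plus (V := R_NormedModule)
      (fun x => fst c * snd (g x)) (fun x => snd c * fst (g x)));
      now apply (is_RInt_scal (V := R_NormedModule)).
Qed.

(** * The remainder *)

(** The difference is [-i alpha1 (x + h0 sin phi) + i h0 alpha2 cos phi], where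
    [cos phi] is at most the distance of [phi] to [3 pi/2]. *)
Lemma Cmod_numerator_le (h0 x L : R) (alpha1 alpha2 : C) (phi : R) :
  1 <= Cmod alpha1 -> 3 * PI / 2 <= phi <= 2 * PI ->
  Rabs (x + h0 * sin phi) <= L * (phi - 3 * PI / 2) ->
  Cmod (- Ci * alpha1 * RtoC x - RtoC h0 * dphase alpha1 alpha2 phi)%C
  <= Cmod alpha1 * (L + Rabs h0 * Cmod alpha2) * (phi - 3 * PI / 2).
Proof.
  intros Hr Hphi Hx.
  replace (- Ci * alpha1 * RtoC x - RtoC h0 * dphase alpha1 alpha2 phi)%C
    with (- (Ci * alpha1 * RtoC (x + h0 * sin phi))
          + Ci * RtoC h0 * alpha2 * RtoC (cos phi))%C.
  2: { unfold dphase. rewrite RtoC_plus, RtoC_mult. ring. }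
  apply Rle_trans with (1 := Cmod_triangle _ _).
  rewrite Cmod_opp, !Cmod_mult, Cmod_Ci, !Cmod_R.
  assert (Hcos : Rabs (cos phi) <= phi - 3 * PI / 2).
  { rewrite <- (sin_sub_3PI2 phi). set (t := phi - 3 * PI / 2).
    assert (Ht : 0 <= t <= PI / 2) by (unfold t; lra).
    pose proof (sin_ge_third t Ht).
    rewrite Rabs_pos_eq by lra.
    destruct (Req_dec t 0) as [E|Hn]; [rewrite E, sin_0; lra|].
    apply Rlt_le, sin_lt_x. lra. }
  assert (Hb : 0 <= Rabs h0 * Cmod alpha2)
    by (apply Rmult_le_pos; [apply Rabs_pos | apply Cmod_ge_0]).
  set (t := phi - 3 * PI / 2) in *. set (b := Rabs h0 * Cmod alpha2) in *.
  assert (Ht : 0 <= t) by (unfold t; lra).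
  assert (Cmod alpha1 * Rabs (x + h0 * sin phi) <= Cmod alpha1 * (L * t))
    by (apply Rmult_le_compat_l; lra).
  assert (b * Rabs (cos phi) <= b * t) by (apply Rmult_le_compat_l; lra).
  assert (b * t <= Cmod alpha1 * (b * t)) by (assert (0 <= b * t) by nra; nra).
  unfold b in *. lra.
Qed.

(** The numerator is [O (r t)] and the modulus of the base is at least
    [rho = delta + q t] with [q] proportional to [r]; hence [r t = O (rho)],
    and of the decay [rho^(-3/2)] the power [rho^(-1/2)] is left, whose
    integral is [O (1 / sqrt r)]. *)
Lemma remainder_bound (h : R -> R) (L M kappa eps nu : R)
  (alpha1 alpha2 G : C) :
  0 <= M -> M < eps -> 0 < kappa -> 0 <= nu -> 0 <= L ->
  1 <= Cmod alpha1 -> kappa * Cmod alpha1 <= Im alpha1 -> Im alpha2 <= M ->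
  (forall phi, 3 * PI / 2 <= phi <= 2 * PI ->
     Rabs (h phi + h (3 * PI / 2) * sin phi) <= L * (phi - 3 * PI / 2)) ->
  is_RInt (V := C_R_NormedModule) (fun phi =>
      ((- Ci * alpha1 * RtoC (h phi)
        - RtoC (h (3 * PI / 2)%R) * dphase alpha1 alpha2 phi)
       * Cpowr (phase alpha1 alpha2 eps phi) (- (nu + 3 / 2)))%C)
    (3 * PI / 2) (2 * PI) G ->
  Cmod G <= 18 * (L + Rabs (h (3 * PI / 2)) * Cmod alpha2)
              * sqrt (eps - M + kappa)
              / (kappa * kappa * Rpower (eps - M) nu) / sqrt (Cmod alpha1).
Proof.
  intros HM Heps Hkappa Hnu HL Hr H1 H2 Hh HG.
  set (h0 := h (3 * PI / 2)) in *. set (delta := eps - M) in *.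
  set (r := Cmod alpha1) in *. set (H := L + Rabs h0 * Cmod alpha2).
  set (q := kappa * r / 3). set (a := 3 * PI / 2) in *.
  assert (Hd : 0 < delta) by (unfold delta; lra).
  assert (Hq : 0 < q) by (unfold q; nra).
  assert (HH : 0 <= H).
  { unfold H. pose proof (Rmult_le_pos _ _ (Rabs_pos h0) (Cmod_ge_0 alpha2)).
    lra. }
  pose proof PI_RGT_0 as HPI. pose proof PI_4 as HPI4.
  assert (Hab : a <= 2 * PI) by (unfold a; lra).
  pose proof (exp_pos (nu * ln delta)) as Hdn.
  change (0 < Rpower delta nu) in Hdn.
  set (K := 3 * H / (kappa * Rpower delta nu)).
  assert (HK : 0 <= K).
  { unfold K. apply Rle_mult_inv_pos; [lra|]. now apply Rmult_lt_0_compat. }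
  pose proof (is_RInt_scal (V := R_NormedModule) _ a (2 * PI) K _
    (is_RInt_inv_sqrt delta q a (2 * PI) Hd Hq Hab)) as Hint.
  pose proof (fun Hb => norm_RInt_le (V := C_R_NormedModule) _ _ a (2 * PI)
    _ _ Hab Hb HG Hint) as Hle.
  rewrite <- Cmod_norm in Hle.
  assert (Hr0 : 0 < sqrt r) by (apply sqrt_lt_R0; lra).
  assert (Hrr : sqrt r * sqrt r = r) by (apply sqrt_sqrt; lra).
  apply Rle_trans with (K * (2 / q * (sqrt (delta + q * (2 * PI - a)) - sqrt delta))).
  - apply Hle. intros phi Hphi.
    rewrite <- Cmod_norm, Cmod_mult, Cmod_Cpowr.
    set (t := phi - a).
    assert (Ht : 0 <= t) by (unfold t; lra).
    set (rho := delta + q * t).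
    assert (Hqt : 0 <= q * t) by (apply Rmult_le_pos; lra).
    assert (Hrho : 0 < rho) by (unfold rho; lra).
    assert (Hm : rho <= Cmod (phase alpha1 alpha2 eps phi)).
    { apply (Cmod_phase_ge M kappa); try assumption; lra. }
    assert (Hdm : delta <= Cmod (phase alpha1 alpha2 eps phi))
      by (unfold rho in Hm; lra).
    pose proof (Rpower_opp_le nu (3 / 2) delta rho _ Hnu ltac:(lra) Hd
      Hdm Hrho Hm) as Hpow.
    pose proof (Cmod_numerator_le h0 (h phi) L alpha1 alpha2 phi Hr Hphi
      (Hh phi Hphi)) as Hnum.
    fold r a H t in Hnum.
    assert (Hs : 0 < sqrt rho) by now apply sqrt_lt_R0.
    assert (E32 : Rpower rho (3 / 2) = rho * sqrt rho).
    { replace (3 / 2) with (1 + / 2) by lra.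
      now rewrite Rpower_plus, Rpower_1, Rpower_sqrt. }
    rewrite E32 in Hpow.
    apply Rle_trans with (r * H * t * / (Rpower delta nu * (rho * sqrt rho))).
    + apply Rmult_le_compat; try assumption; [apply Cmod_ge_0|].
      apply Rlt_le, exp_pos.
    + change (scal K (/ sqrt rho)) with (K * / sqrt rho).
      (* One factor [rho] of the denominator absorbs [r t]. *)
      assert (Hrt : r * t <= 3 * rho / kappa).
      { apply Rmult_le_reg_l with (kappa / 3); [lra|].
        replace (kappa / 3 * (3 * rho / kappa)) with rho by (field; lra).
        unfold rho, q. lra. }
      replace (K * / sqrt rho)
        with (3 * rho / kappa * (H * / (Rpower delta nu * (rho * sqrt rho))))
        by (unfold K; field; repeat split; lra).
      replace (r * H * t * / (Rpower delta nu * (rho * sqrt rho)))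
        with (r * t * (H * / (Rpower delta nu * (rho * sqrt rho)))) by ring.
      apply Rmult_le_compat_r; [|exact Hrt].
      apply Rle_mult_inv_pos; [exact HH|].
      repeat apply Rmult_lt_0_compat; assumption.
  - assert (Hroot : sqrt (delta + q * (2 * PI - a)) <= sqrt r * sqrt (delta + kappa)).
    { rewrite <- sqrt_mult by lra. apply sqrt_le_1_alt.
      unfold q, a.
      assert (kappa * r / 3 * (2 * PI - 3 * PI / 2) <= kappa * r).
      { assert (0 < kappa * r) by nra.
        replace (kappa * r / 3 * (2 * PI - 3 * PI / 2))
          with (kappa * r * (PI / 6)) by field. nra. }
      nra. }
    pose proof (sqrt_pos delta) as Hsd.
    replace (18 * H * sqrt (delta + kappa)
             / (kappa * kappa * Rpower delta nu) / sqrt r)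
      with (K * (2 / q * (sqrt r * sqrt (delta + kappa)))).
    2: { unfold K, q. rewrite <- Hrr at 1. field.
         repeat split; lra. }
    apply Rmult_le_compat_l; [exact HK|].
    apply Rmult_le_compat_l; [|lra].
    apply Rle_mult_inv_pos; lra.
Qed.

(** * Asymptotics of the integral *)

Lemma is_RInt_I_pm (f : R -> R -> R) (nu eps : R) (alpha1 alpha2 : C) :
  (forall phi, 3 * PI / 2 <= phi <= 2 * PI -> continuous (f (PI / 2)) phi) ->
  (forall phi, 3 * PI / 2 <= phi <= 2 * PI ->
     0 < Re (phase alpha1 alpha2 eps phi)) ->
  is_RInt (V := C_R_NormedModule) (fun phi =>
      (RtoC (f (PI / 2)%R phi)
       * Cpowr (phase alpha1 alpha2 eps phi) (- (nu + 3 / 2)))%C)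
    (3 * PI / 2) (2 * PI) (I_pm f nu eps alpha1 alpha2).
Proof.
  intros Hcont Hpos. pose proof PI_RGT_0.
  unfold I_pm.
  apply (is_RInt_ext (V := C_R_NormedModule) (fun phi =>
    (RtoC (f (PI / 2)%R phi)
     / Cpowr (phase alpha1 alpha2 eps phi) (nu + 3 / 2))%C)).
  { intros phi _. now rewrite Cpowr_opp. }
  apply (RInt_correct (V := C_R_CompleteNormedModule)).
  apply (ex_RInt_continuous (V := C_R_CompleteNormedModule)).
  rewrite Rmin_left, Rmax_right by lra. intros phi Hphi.
  apply (continuous_ext (U := C_R_NormedModule) (fun phi =>
    (RtoC (f (PI / 2)%R phi)
     * Cpowr (phase alpha1 alpha2 eps phi) (- (nu + 3 / 2)))%C)).
  { intros s. now rewrite Cpowr_opp. }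
  apply continuous_Cmult.
  - apply continuous_C_pair; simpl.
    + now apply Hcont.
    + apply continuous_const.
  - apply continuous_Cpowr_phase. now apply Hpos.
Qed.

Lemma phase_3PI2 (alpha1 alpha2 : C) (eps : R) :
  phase alpha1 alpha2 eps (3 * PI / 2) = (RtoC eps + Ci * alpha2)%C.
Proof.
  unfold phase. replace (3 * PI / 2) with (3 * (PI / 2)) by field.
  rewrite cos_3PI2, sin_3PI2.
  unfold Ci, RtoC, Cplus, Cmult, Copp; simpl. f_equal; ring.
Qed.

Lemma RtoC_neq_0 (x : R) : x <> 0 -> RtoC x <> RtoC 0.
Proof. intros Hx E. apply Hx. now apply RtoC_inj. Qed.

(** In this form [Lambda1] is visibly the contribution of the lower endpoint to
    the exact integral, where the primitive is a multiple of [phase^w] with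
    [w = -(nu + 1/2)]. *)
Lemma Lambda1_phase (f : R -> R -> R) (nu eps : R) (alpha1 alpha2 : C) :
  0 <= nu ->
  Lambda1 f nu alpha2 eps
  = (- Ci * RtoC (f (PI / 2)%R (3 * PI / 2)%R) / RtoC (- (nu + 1 / 2))
     * Cpowr (phase alpha1 alpha2 eps (3 * PI / 2)) (- (nu + 1 / 2)))%C.
Proof.
  intros Hnu. unfold Lambda1.
  rewrite phase_3PI2, Cpowr_opp, RtoC_opp.
  replace (1 + 2 * nu) with (2 * (nu + 1 / 2)) by field.
  rewrite RtoC_mult.
  assert (Hw : RtoC (nu + 1 / 2) <> RtoC 0) by (apply RtoC_neq_0; lra).
  assert (H2 : RtoC 2 <> RtoC 0) by (apply RtoC_neq_0; lra).
  pose proof (Cpowr_neq_0 (RtoC eps + Ci * alpha2) (nu + 1 / 2)) as Hp.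
  field. auto.
Qed.

Lemma Ci_Ci : (Ci * Ci)%C = (- RtoC 1)%C.
Proof. unfold Ci, RtoC, Cmult, Copp; simpl. f_equal; ring. Qed.

(** The condition [kappa |alpha1| <= Im alpha1] describes a closed sector of
    the open upper half-plane. The error consists of the remainder integral and
    of the upper endpoint of the exact one; both are [O (|alpha1|^(-1/2))]. *)
Lemma I_pm_error (f : R -> R -> R) (M kappa eps nu : R) (alpha2 : C) :
  0 <= M -> M < eps -> 0 < kappa -> 0 <= nu -> Im alpha2 <= M ->
  ex_derive (f (PI / 2)) (3 * PI / 2) ->
  (forall phi, 3 * PI / 2 <= phi <= 2 * PI -> continuous (f (PI / 2)) phi) ->
  (forall phi, 3 * PI / 2 <= phi <= 2 * PI -> Rabs (f (PI / 2) phi) <= 1) ->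
  exists K, forall alpha1 : C,
    1 <= Cmod alpha1 -> kappa * Cmod alpha1 <= Im alpha1 ->
    Cmod (alpha1 * I_pm f nu eps alpha1 alpha2 - Lambda1 f nu alpha2 eps)%C
    <= K / sqrt (Cmod alpha1).
Proof.
  intros HM Heps Hkappa Hnu H2 Hder Hcont Hbound.
  pose proof PI_RGT_0 as HPI. pose proof PI2_3_2 as HPI3.
  set (h := f (PI / 2)) in *. set (h0 := h (3 * PI / 2)).
  assert (Esin : sin (3 * PI / 2) = -1).
  { replace (3 * PI / 2) with (3 * (PI / 2)) by field. apply sin_3PI2. }
  destruct (linear_bound (fun phi => h phi + h0 * sin phi) (3 * PI / 2) (2 * PI)
              2) as [L [HL Hh]].
  { apply (ex_derive_plus (V := R_NormedModule)); [exact Hder|].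
    auto_derive. exact I. }
  { rewrite Esin. unfold h0. ring. }
  { intros phi Hphi.
    apply Rle_trans with (1 := Rabs_triang _ _). rewrite Rabs_mult.
    pose proof (Hbound phi Hphi). pose proof (Hbound (3 * PI / 2) ltac:(lra)).
    fold h0 in H0.
    assert (Rabs (sin phi) <= 1) by (apply Rabs_le, SIN_bound).
    pose proof (Rabs_pos h0). pose proof (Rabs_pos (sin phi)). nra. }
  set (delta := eps - M).
  set (w := - (nu + 1 / 2)).
  (* [K1] bounds the remainder integral, [K2] the upper endpoint. *)
  set (K1 := 18 * (L + Rabs h0 * Cmod alpha2) * sqrt (delta + kappa)
             / (kappa * kappa * Rpower delta nu)).
  set (K2 := Rabs h0 / (nu + 1 / 2) / (Rpower delta nu * sqrt (kappa / 3))).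
  exists (K1 + K2). intros alpha1 Hr H1.
  set (r := Cmod alpha1) in *.
  assert (Him : 0 < Im alpha1) by nra.
  assert (Hpos : forall phi, 3 * PI / 2 <= phi <= 2 * PI ->
            0 < Re (phase alpha1 alpha2 eps phi)).
  { intros phi Hphi.
    pose proof (Re_phase_ge M eps alpha1 alpha2 phi HM ltac:(lra) H2 Hphi).
    assert (0 <= Im alpha1 / 3 * (phi - 3 * PI / 2))
      by (apply Rmult_le_pos; lra).
    lra. }
  set (Pa := Cpowr (phase alpha1 alpha2 eps (3 * PI / 2)) w).
  set (Pb := Cpowr (phase alpha1 alpha2 eps (2 * PI)) w).
  set (I0 := I_pm f nu eps alpha1 alpha2).
  assert (Hw : RtoC w <> RtoC 0) by (apply RtoC_neq_0; unfold w; lra).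
  set (G := (- Ci * alpha1 * I0 - RtoC h0 / RtoC w * (Pb - Pa))%C).
  assert (HG : Cmod G <= K1 / sqrt r).
  { apply (remainder_bound h L M kappa eps nu alpha1 alpha2 G); try assumption.
    apply (is_RInt_ext (V := C_R_NormedModule) (fun phi => minus
      (- Ci * alpha1 * (RtoC (h phi)
         * Cpowr (phase alpha1 alpha2 eps phi) (- (nu + 3 / 2))))%C
      (RtoC h0 / RtoC w * (RtoC w * dphase alpha1 alpha2 phi
         * Cpowr (phase alpha1 alpha2 eps phi) (w - 1)))%C)).
    { intros phi _.
      replace (w - 1) with (- (nu + 3 / 2)) by (unfold w; field).
      change ((- Ci * alpha1 * (RtoC (h phi)
         * Cpowr (phase alpha1 alpha2 eps phi) (- (nu + 3 / 2)))
       - RtoC h0 / RtoC w * (RtoC w * dphase alpha1 alpha2 phi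
         * Cpowr (phase alpha1 alpha2 eps phi) (- (nu + 3 / 2))))%C
       = ((- Ci * alpha1 * RtoC (h phi) - RtoC h0 * dphase alpha1 alpha2 phi)
          * Cpowr (phase alpha1 alpha2 eps phi) (- (nu + 3 / 2)))%C).
      field. exact Hw. }
    apply (is_RInt_minus (V := C_R_NormedModule)).
    - apply is_RInt_Cmult_l. now apply is_RInt_I_pm.
    - apply is_RInt_Cmult_l. apply is_RInt_Cpowr_phase; [lra | exact Hpos]. }
  assert (Hsplit : (alpha1 * I0 - Lambda1 f nu alpha2 eps)%C
                   = (Ci * (G + RtoC h0 / RtoC w * Pb))%C).
  { rewrite (Lambda1_phase f nu eps alpha1 alpha2 Hnu).
    fold h. fold h0. fold w. fold Pa. unfold G.
    transitivity (- (Ci * Ci) * alpha1 * I0 + Ci * RtoC h0 / RtoC w * Pa)%C.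
    - rewrite Ci_Ci. field. exact Hw.
    - field. exact Hw. }
  rewrite Hsplit, Cmod_mult, Cmod_Ci, Rmult_1_l.
  apply Rle_trans with (1 := Cmod_triangle _ _).
  replace ((K1 + K2) / sqrt r) with (K1 / sqrt r + K2 / sqrt r)
    by (unfold Rdiv; ring).
  apply Rplus_le_compat; [exact HG|].
  rewrite Cmod_mult, Cmod_div, !Cmod_R by exact Hw.
  assert (Hdelta : 0 < delta) by (unfold delta; lra).
  assert (HPb : Cmod Pb <= / (Rpower delta nu * sqrt (kappa / 3 * r))).
  { unfold Pb. rewrite Cmod_Cpowr. unfold w.
    rewrite <- (Rpower_sqrt (kappa / 3 * r)) by nra.
    replace (1 / 2) with (/ 2) by field.
    pose proof (Cmod_phase_ge M kappa eps alpha1 alpha2 (2 * PI) HM ltac:(lra)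
      H1 H2 ltac:(lra)) as Hge.
    fold r in Hge. fold delta in Hge.
    (* The interval has length [pi/2 > 1]. *)
    assert (Hkr : kappa / 3 * r <= kappa * r / 3 * (2 * PI - 3 * PI / 2)).
    { assert (0 < kappa * r) by nra. nra. }
    apply Rpower_opp_le; nra. }
  assert (Ew : Rabs w = nu + 1 / 2)
    by (unfold w; rewrite Rabs_Ropp; apply Rabs_pos_eq; lra).
  rewrite Ew.
  rewrite sqrt_mult in HPb by lra.
  assert (0 < sqrt r) by (apply sqrt_lt_R0; lra).
  assert (0 < sqrt (kappa / 3)) by (apply sqrt_lt_R0; lra).
  pose proof (exp_pos (nu * ln delta)) as Hdn.
  change (0 < Rpower delta nu) in Hdn.
  replace (K2 / sqrt r) with (Rabs h0 / (nu + 1 / 2)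
    * / (Rpower delta nu * (sqrt (kappa / 3) * sqrt r)))
    by (unfold K2; field; repeat split; lra).
  apply Rmult_le_compat_l; [|exact HPb].
  apply Rle_mult_inv_pos; [apply Rabs_pos | lra].
Qed.

Theorem mainTheorem3
  (gamma1 gamma2 : R -> C)
  (Hgamma1 : is_contour gamma1) (Hgamma2 : is_contour gamma2)
  (M : R) (HM : 0 < M)
  (HM1 : forall z : C, UHP gamma1 z -> - M <= Im z)
  (HM2 : forall z : C, LHP gamma2 z -> Im z <= M)
  (l1 : R) (Hl1 : is_first_eigenvalue l1)
  (u : R3 -> R) (Hu : is_eigenfunction l1 u)
  (f : R -> R -> R) (Hf : f = in_spherical_coords u)
  (Hf_trace : equatorial_trace_properties (f (PI / 2)))
  (nu : R) (Hnu : nu = exponent l1)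
  (eps : R) (Heps : 2 * M < eps)
  (alpha2 : C) (Halpha2 : LHP gamma2 alpha2)
  (phi1 : R) (Hphi1 : 0 < phi1 < PI) :
  asymp_equiv
    (within (fun r : R => UHP gamma1 (polar r phi1)) (Rbar_locally p_infty))
    (fun r : R => I_pm f nu eps (polar r phi1) alpha2)
    (fun r : R => (Lambda1 f nu alpha2 eps / polar r phi1)%C).
Proof.
  pose proof PI_RGT_0 as HPI.
  assert (Hnu0 : 0 <= nu) by (rewrite Hnu; apply sqrt_pos).
  assert (Hsin : 0 < sin phi1) by (apply sin_gt_0; lra).
  assert (Hcont : forall phi, continuous (f (PI / 2)) phi).
  { intros phi. rewrite Hf. now apply (continuous_eigenfunction_sph l1). }
  assert (Hend : f (PI / 2) (2 * PI) = 0).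
  { rewrite <- (trace_cut _ Hf_trace 0) by lra. rewrite Hf.
    unfold in_spherical_coords, sph.
    now rewrite cos_2PI, sin_2PI, cos_0, sin_0. }
  assert (Hh0 : 0 < f (PI / 2) (3 * PI / 2))
    by (apply (trace_range _ Hf_trace); lra).
  destruct (I_pm_error f M (sin phi1) eps nu alpha2) as [K HK];
    try lra; try (now intros; apply Hcont).
  { now apply HM2. }
  { apply (trace_smooth _ Hf_trace 1). lra. }
  { intros phi Hphi. destruct (Req_dec phi (2 * PI)) as [E|Hne].
    - rewrite E, Hend, Rabs_R0. lra.
    - pose proof (trace_range _ Hf_trace phi ltac:(lra)).
      rewrite Rabs_pos_eq; lra. }
  set (Lam := Lambda1 f nu alpha2 eps) in *.
  assert (HLam : Lam <> RtoC 0).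
  { unfold Lam. rewrite (Lambda1_phase f nu eps (RtoC 0)) by assumption.
    repeat apply Cmult_neq_0.
    - apply Cmod_gt_0. rewrite Cmod_opp, Cmod_Ci. lra.
    - apply RtoC_neq_0. lra.
    - rewrite <- RtoC_inv by lra. apply RtoC_neq_0.
      apply Rinv_neq_0_compat. lra.
    - apply Cpowr_neq_0. }
  assert (HLam0 : 0 < Cmod Lam) by now apply Cmod_gt_0.
  apply filterlim_locally. intros e. unfold within.
  pose proof (cond_pos e) as He.
  set (q := Rabs K / (e * Cmod Lam)).
  assert (Hq : 0 <= q).
  { apply Rle_mult_inv_pos; [apply Rabs_pos | now apply Rmult_lt_0_compat]. }
  (* Beyond [1 + q^2] one has [sqrt r > q], that is, [K / sqrt r < e |Lam|]. *)
  exists (1 + q * q). intros r Hr _.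
  assert (Hr1 : 1 < r) by nra.
  assert (Hmod : Cmod (polar r phi1) = r) by (apply Cmod_polar; lra).
  assert (Hpol : polar r phi1 <> RtoC 0) by (apply Cmod_gt_0; lra).
  apply C_NormedModule_mixin_compat1.
  change (Cmod (I_pm f nu eps (polar r phi1) alpha2
    / (Lam / polar r phi1) - RtoC 1)%C < e).
  set (I0 := I_pm f nu eps (polar r phi1) alpha2).
  specialize (HK (polar r phi1)). fold I0 in HK. rewrite Hmod in HK.
  specialize (HK ltac:(lra) ltac:(simpl; lra)).
  replace (I0 / (Lam / polar r phi1) - RtoC 1)%C
    with ((polar r phi1 * I0 - Lam) / Lam)%C by (field; auto).
  rewrite Cmod_div by assumption.
  apply Rmult_lt_reg_r with (Cmod Lam); [assumption|].
  replace (Cmod (polar r phi1 * I0 - Lam) / Cmod Lam * Cmod Lam)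
    with (Cmod (polar r phi1 * I0 - Lam)) by (field; lra).
  apply Rle_lt_trans with (1 := HK).
  assert (Hs : q < sqrt r).
  { rewrite <- (sqrt_square q) by assumption. apply sqrt_lt_1_alt. nra. }
  assert (Hs0 : 0 < sqrt r) by lra.
  apply Rmult_lt_reg_r with (sqrt r); [assumption|].
  replace (K / sqrt r * sqrt r) with K by (field; lra).
  apply Rle_lt_trans with (1 := Rle_abs K).
  replace (Rabs K) with (e * Cmod Lam * q)
    by (unfold q; field; split; lra).
  apply Rmult_lt_compat_l; [now apply Rmult_lt_0_compat | assumption].
Qed.
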